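(* Let $X_1,\dots,X_m\in\mathbb{M}_n$ be such that their sum $\sum_{k=1}^m X_k$ is polar Hermitian. Then $$ \left|\sum_{k=1}^m X_k\right|_{\mathrm{sym}}\prec_{\mathrm{wlog}}\sum_{k=1}^m |X_k|_{\mathrm{sym}}. $$
   Context: $\mathbb{M}_n$ is the space of complex $n\times n$ matrices. For $Z\in\mathbb{M}_n$, $|Z|=(Z^*Z)^{1/2}$ and $|Z|_{\mathrm{sym}}=\frac{|Z|+|Z^*|}{2}$. A matrix $S\in\mathbb{M}_n$ is called polar Hermitian if it has a polar decomposition $S=V|S|$ (with $V$ unitary) in which $V$ is a scalar multiple of a Hermitian unitary. For positive semidefinite $S,T\in\mathbb{M}_n$, the weak log-majorisation $S\prec_{\mathrm{wlog}}T$ means $\prod_{j=1}^k\lambda_j^{\downarrow}(S)\le\prod_{j=1}^k\lambda_j^{\downarrow}(T)$ for all $k=1,\dots,n$, where $\lambda_1^{\downarrow}\ge\cdots\ge\lambda_n^{\downarrow}$ denote the eigenvalues in nonincreasing order counted with multiplicity. *)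

(* Defs.v *)
From HB Require Import structures.
From mathcomp Require Import all_boot all_order all_algebra.
From mathcomp Require Import spectral sesquilinear.
From mathcomp Require Import complex reals.

Set Implicit Arguments.
Unset Strict Implicit.
Unset Printing Implicit Defensive.

Import Order.TTheory GRing.Theory Num.Theory.

Local Open Scope ring_scope.
Local Open Scope complex_scope.
Local Open Scope sesquilinear_scope.

Section Defs.
Variables (R : realType) (n : nat).
Local Notation C := R[i].
Implicit Types A S T V Z : 'M[C]_n.

(* The order on [R[i]] is the partial one: [0 <= z] says that [z] is real and
   nonnegative. *)
Definition psdmx A : Prop :=
  A \is hermsymmx /\ forall v : 'cV[C]_n, 0 <= (v ^t* *m A *m v) 0 0.

(* Functional calculus: for [A] normal, [A = P^* diag(d) P] with
   [P = spectralmx A] unitary and [d = spectral_diag A]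
   ([orthomx_spectralP]); see [sqrtmx_psd] and [sqrtmxK] for [A] positive
   semidefinite. *)
Definition sqrtmx A : 'M[C]_n :=
  (spectralmx A) ^t* *m diag_mx (map_mx sqrtC (spectral_diag A))
    *m spectralmx A.

Definition absmx Z : 'M[C]_n := sqrtmx (Z ^t* *m Z).

Definition symabs Z : 'M[C]_n := 2^-1 *: (absmx Z + absmx (Z ^t*)).

Definition polar_hermitian S : Prop :=
  exists V, [/\ V \is unitarymx, S = V *m absmx S &
    exists (c : C) (H : 'M[C]_n),
      [/\ H \is hermsymmx, H \is unitarymx & V = c *: H]].

(* The roots of the characteristic polynomial, with multiplicity. *)
Definition eigenvalues A : seq C :=
  sval (closed_field_poly_normal (char_poly A)).

(* Meaningful for matrices with real spectrum; taking real parts is then only a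
   change of type (see [psd_eigenvalues]). *)
Definition eigs_down A : seq R :=
  sort (fun x y : R => y <= x) [seq complex.Re z | z <- eigenvalues A].

(* Used only for positive semidefinite [S] and [T] (see [symabs_psd] and
   [psdmx_sum]). *)
Definition wlog_maj S T : Prop :=
  forall k : nat, (1 <= k <= n)%N ->
    \prod_(j < k) (eigs_down S)`_j <= \prod_(j < k) (eigs_down T)`_j.

Lemma eigenvaluesE A : char_poly A = \prod_(z <- eigenvalues A) ('X - z%:P).
Proof.
rewrite /eigenvalues; case: closed_field_poly_normal => r /= ->.
rewrite [X in X *: _](_ : _ = 1) ?scale1r //.
exact/monicP/char_poly_monic.
Qed.

Lemma size_eigs_down A : size (eigs_down A) = n.
Proof.
rewrite size_sort size_map; apply/succn_inj.
by rewrite -(size_prod_XsubC _ id) -eigenvaluesE size_char_poly.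
Qed.

Lemma hermE A : (A \is hermsymmx) = (A == A ^t*).
Proof. by rewrite qualifE /= expr0 scale1r. Qed.

Lemma trCM m1 m2 m3 (A : 'M[C]_(m1, m2)) (B : 'M[C]_(m2, m3)) :
  (A *m B) ^t* = B ^t* *m A ^t*.
Proof. by rewrite trmx_mul map_mxM. Qed.

Lemma normsq_ge0 (v : 'cV[C]_n) : 0 <= (v ^t* *m v) 0 0.
Proof.
rewrite mxE sumr_ge0 // => i _.
by rewrite !mxE mulrC mul_conjC_ge0.
Qed.

Lemma gram_psd Z : psdmx (Z ^t* *m Z).
Proof.
split; first by rewrite hermE trCM trmxCK.
by move=> v; rewrite mulmxA -mulmxA -trCM normsq_ge0.
Qed.

Lemma psdmxD A B : psdmx A -> psdmx B -> psdmx (A + B).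
Proof.
move=> [hA pA] [hB pB]; split.
  by move: hA hB; rewrite !hermE linearD /= map_mxD => /eqP <- /eqP <-.
by move=> v; rewrite mulmxDr mulmxDl mxE addr_ge0.
Qed.

Lemma psdmx0 : psdmx 0.
Proof.
split; first by rewrite hermE linear0 map_mx0.
by move=> v; rewrite mulmx0 mul0mx mxE.
Qed.

Lemma psdmxZ (c : C) A : 0 <= c -> psdmx A -> psdmx (c *: A).
Proof.
move=> c0 [hA pA]; split.
  move: hA; rewrite !hermE linearZ /= map_mxZ => /eqP <-.
  by apply/eqP; congr (_ *: _); apply/esym/CrealP/ger0_real.
by move=> v; rewrite -scalemxAr -scalemxAl mxE mulr_ge0.
Qed.

Lemma psdmx_sum (I : finType) (F : I -> 'M[C]_n) :
  (forall i, psdmx (F i)) -> psdmx (\sum_i F i).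
Proof.
move=> pF; elim/big_ind : _ => [|A B|i _]; [exact: psdmx0|exact: psdmxD|].
exact: pF.
Qed.

Lemma spectralE A : psdmx A ->
  A = (spectralmx A) ^t* *m diag_mx (spectral_diag A) *m spectralmx A.
Proof.
move=> [hA _]; rewrite -invmx_unitary ?spectral_unitarymx //.
exact/orthomx_spectralP/hermitian_normalmx.
Qed.

Lemma spectral_diag_ge0 A i : psdmx A -> 0 <= spectral_diag A 0 i.
Proof.
move=> pA; set P := spectralmx A.
have PP : P *m P ^t* = 1%:M by apply/unitarymxP/spectral_unitarymx.
have [_ /(_ (P ^t* *m delta_mx i 0))] := pA.
rewrite {1}(spectralE pA) -/P trCM trmxCK !mulmxA.
rewrite -[_ *m P *m P ^t*]mulmxA PP mulmx1 -[_ *m P *m P ^t*]mulmxA PP mulmx1.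
have -> : (delta_mx i 0 : 'cV[C]_n) ^t* = delta_mx 0 i.
  by apply/matrixP => a b; rewrite !mxE andbC conjC_nat.
by rewrite -rowE -colE !mxE eqxx mulr1n.
Qed.

Lemma diag_psd (d : 'rV[C]_n) (P : 'M[C]_n) :
  (forall i, 0 <= d 0 i) -> psdmx (P ^t* *m diag_mx d *m P).
Proof.
move=> d0; pose s := diag_mx (map_mx sqrtC d).
have ss : s ^t* = s.
  apply/matrixP => i j; rewrite !mxE rmorphMn /= eq_sym.
  case: eqP => [->|_]; last by rewrite !mulr0n.
  by rewrite !mulr1n; apply/CrealP/ger0_real; rewrite sqrtC_ge0.
have -> : diag_mx d = s ^t* *m s.
  rewrite ss mulmx_diag; congr diag_mx.
  by apply/rowP => i; rewrite !mxE -expr2 sqrtCK.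
by rewrite mulmxA -mulmxA -trCM; apply: gram_psd.
Qed.

Lemma sqrtmx_psd A : psdmx A -> psdmx (sqrtmx A).
Proof.
by move=> pA; apply: diag_psd => i; rewrite mxE sqrtC_ge0 spectral_diag_ge0.
Qed.

Lemma sqrtmxK A : psdmx A -> sqrtmx A *m sqrtmx A = A.
Proof.
move=> pA; rewrite [RHS](spectralE pA) /sqrtmx; set P := spectralmx A.
have PP : P *m P ^t* = 1%:M by apply/unitarymxP/spectral_unitarymx.
rewrite !mulmxA -[_ *m P *m P ^t*]mulmxA PP mulmx1.
rewrite -[_ *m diag_mx _ *m diag_mx _]mulmxA mulmx_diag.
congr (_ *m diag_mx _ *m _).
by apply/rowP => i; rewrite !mxE -expr2 sqrtCK.
Qed.

Lemma absmx_psd Z : psdmx (absmx Z).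
Proof. exact/sqrtmx_psd/gram_psd. Qed.

Lemma absmx_sqr Z : absmx Z *m absmx Z = Z ^t* *m Z.
Proof. exact/sqrtmxK/gram_psd. Qed.

Lemma symabs_psd Z : psdmx (symabs Z).
Proof.
apply: psdmxZ; first by rewrite invr_ge0 ler0n.
by apply: psdmxD; exact: absmx_psd.
Qed.

Lemma psd_eigenvalues A z : psdmx A -> z \in eigenvalues A ->
  0 <= z /\ z = (complex.Re z)%:C.
Proof.
move=> pA zA; have z0 : 0 <= z.
  have : root (char_poly A) z by rewrite eigenvaluesE root_prod_XsubC.
  rewrite -eigenvalue_root_char => /eigenvalueP[v vA v0].
  have [_ /(_ (v ^t*))] := pA.
  rewrite trmxCK vA -scalemxAl mxE.
  suff v_gt0 : 0 < (v *m v ^t*) 0 0 by rewrite pmulr_lge0.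
  by rewrite -dotmxE dnorm_gt0.
split=> //; case: z z0 {zA} => a b; rewrite lecE /= => /andP[/eqP -> _].
by [].
Qed.

End Defs.

(* Main.v *)
Require Import Defs.
From mathcomp Require Import all_boot all_order all_algebra.
From mathcomp Require Import fingroup perm spectral sesquilinear.
From mathcomp Require Import complex reals ring.

(** Write [S] for the sum of the [X k], [T] for the sum of the [symabs (X k)]
    and [N] for [symabs S].  Polar Hermitian means [S = V |S|] with [V = c H],
    [H] a Hermitian unitary and [|c| = 1].  Then [|S^*| = V |S| V^* = H |S| H],
    so that [2 N = |S| + H |S| H], and the Hermitian matrix [M] with
    [2 M = c^* S + c S^* = H |S| + |S| H], a rotated real part of [S],
    satisfies [H M = M H = N].  In particular [N^2 = M^2], so by uniqueness of
    positive square roots [N] is the absolute value of [M]: an eigenvector of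
    [M] for [x] is one of [N] for [|x|] ([polar_hermitian_mean],
    [psd_sqr_inj]).

    The map taking [S] to [M] is additive, unlike the absolute value, and the
    rotated real part of any [X] lies between [- symabs X] and [symabs X]: if
    [|X| = s^* s], [|X^*| = Y^* Y] and [X^* = s^* Y], then
    [(s - c Y)^* (s - c Y) = |X| + |X^*| - c^* X - c X^*] is positive
    semidefinite, and [c] may be replaced by [- c] ([polar_factor],
    [symabs_sub_psd]).  Summing over [k] yields [- T <= M <= T].

    It remains to compare products of eigenvalues ([prod_eigs_sandwich]).  Let
    the rows of [U] come from an orthonormal eigenbasis of [M] and carry the
    [k] largest eigenvalues of [N].  Compression by [U] preserves the sandwich,
    and a sandwich [- B <= A <= B] of Hermitian matrices implies
    [|det A| <= det B] by simultaneous diagonalization ([det_sandwich]).  The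
    left-hand side is the product of the [k] largest eigenvalues of [N] because
    [U M U^*] is diagonal; the right-hand side, the determinant of [U T U^*],
    is at most the product of the [k] largest eigenvalues of [T] by Cauchy
    interlacing ([interlacing], [det_compression_le]). *)

Import Order.TTheory GRing.Theory Num.Theory.

Section NumClosedField.

Local Set Implicit Arguments.
Local Unset Strict Implicit.
Local Unset Printing Implicit Defensive.
Local Open Scope ring_scope.
Local Open Scope sesquilinear_scope.

Variable C : numClosedFieldType.

(** * Conjugate transposes and unitary conjugation *)

Lemma trCD m n (A B : 'M[C]_(m, n)) : (A + B) ^t* = A ^t* + B ^t*.
Proof. by rewrite linearD /= map_mxD. Qed.

Lemma trCZ m n (a : C) (A : 'M[C]_(m, n)) : (a *: A) ^t* = a^* *: A ^t*.
Proof. by rewrite linearZ /= map_mxZ. Qed.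

Lemma trC_sum (I : finType) m n (F : I -> 'M[C]_(m, n)) :
  (\sum_i F i) ^t* = \sum_i (F i) ^t*.
Proof.
apply: (big_morph (fun A : 'M[C]_(m, n) => A ^t*)) => [A B|].
  exact: trCD.
by rewrite linear0 map_mx0.
Qed.

Lemma trC_mul m1 m2 m3 (A : 'M[C]_(m1, m2)) (B : 'M[C]_(m2, m3)) :
  (A *m B) ^t* = B ^t* *m A ^t*.
Proof. by rewrite trmx_mul map_mxM. Qed.

Lemma trC_diag n (d : 'rV[C]_n) :
  (forall i, d 0 i \is Num.real) -> (diag_mx d) ^t* = diag_mx d.
Proof.
move=> dr; apply/matrixP => i j; rewrite !mxE rmorphMn /= eq_sym.
case: eqP => [->|_]; last by rewrite !mulr0n.
by rewrite !mulr1n; apply/CrealP.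
Qed.

Lemma trC_conj m n (A : 'M[C]_n) (B : 'M[C]_(m, n)) :
  A ^t* = A -> (B *m A *m B ^t*) ^t* = B *m A *m B ^t*.
Proof. by move=> hA; rewrite !trC_mul trmxCK hA mulmxA. Qed.

Lemma gramE m n (B : 'M[C]_(m, n)) i j :
  (B *m B ^t*) i j = \sum_a B i a * (B j a)^*.
Proof. by rewrite mxE; apply: eq_bigr => a _; rewrite !mxE. Qed.

Lemma diag_conjE m n (B : 'M[C]_(m, n)) (d : 'rV[C]_n) i j :
  (B *m diag_mx d *m B ^t*) i j = \sum_a d 0 a * (B i a * (B j a)^*).
Proof.
rewrite mul_mx_diag mxE; apply: eq_bigr => a _.
by rewrite !mxE mulrA [d 0 a * _]mulrC.
Qed.

Lemma rowsub_conj k m n (f : 'I_k -> 'I_m) (B : 'M[C]_(m, n)) (A : 'M[C]_n) :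
  rowsub f B *m A *m (rowsub f B) ^t* = mxsub f f (B *m A *m B ^t*).
Proof.
apply/matrixP => i j; rewrite [LHS]mxE [RHS]mxE [RHS]mxE.
apply: eq_bigr => a _; rewrite !mxE; congr (_ * _).
by apply: eq_bigr => b _; rewrite mxE.
Qed.

Lemma mxsub_diag k n (f : 'I_k -> 'I_n) (d : 'rV[C]_n) :
  injective f -> mxsub f f (diag_mx d) = diag_mx (\row_i d 0 (f i)).
Proof. by move=> f_inj; apply/matrixP => i j; rewrite !mxE (inj_eq f_inj). Qed.

Lemma rowsub_unitarymx k m n (f : 'I_k -> 'I_m) (P : 'M[C]_(m, n)) :
  injective f -> P \is unitarymx -> rowsub f P \is unitarymx.
Proof.
move=> f_inj /unitarymxP/matrixP PP; apply/unitarymxP/matrixP => i j.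
have := PP (f i) (f j); rewrite !gramE !mxE (inj_eq f_inj) => <-.
by apply: eq_bigr => a _; rewrite !mxE.
Qed.

Lemma unitarymxK n (P : 'M[C]_n) : P \is unitarymx -> P ^t* *m P = 1%:M.
Proof. by move=> /unitarymxP /mulmx1C. Qed.

Lemma unitary_diagK n (P : 'M[C]_n) (d : 'rV[C]_n) : P \is unitarymx ->
  P *m (P ^t* *m diag_mx d *m P) *m P ^t* = diag_mx d.
Proof.
move=> uP; rewrite !mulmxA (unitarymxP uP) mul1mx -mulmxA.
by rewrite (unitarymxP uP) mulmx1.
Qed.

Lemma unitary_diag_sqr n (P A : 'M[C]_n) (d : 'rV[C]_n) : P \is unitarymx ->
  A = P ^t* *m diag_mx d *m P ->
  A *m A = P ^t* *m diag_mx (\row_i d 0 i ^+ 2) *m P.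
Proof.
move=> uP ->.
have -> : P ^t* *m diag_mx d *m P *m (P ^t* *m diag_mx d *m P)
    = P ^t* *m (diag_mx d *m (P *m P ^t*) *m diag_mx d) *m P.
  by rewrite !mulmxA.
by rewrite (unitarymxP uP) mulmx1 mulmx_diag.
Qed.

Lemma unitary_conj_sqr n (a V : 'M[C]_n) : V \is unitarymx -> a ^t* = a ->
  (V *m a *m V ^t*) *m (V *m a *m V ^t*) = V *m a *m (V *m a) ^t*.
Proof.
move=> uV ha; rewrite trC_mul ha !mulmxA.
by rewrite -(mulmxA _ (V ^t*) V) unitarymxK // mulmx1.
Qed.

Lemma unitary_change_basis k n (P A : 'M[C]_n) (U : 'M[C]_(k, n))
    (Q : 'M[C]_k) : P \is unitarymx ->
  Q *m U *m P ^t* *m (P *m A *m P ^t*) *m (Q *m U *m P ^t*) ^t*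
    = Q *m (U *m A *m U ^t*) *m Q ^t*.
Proof.
move=> uP; rewrite !trC_mul trmxCK !mulmxA.
rewrite -(mulmxA _ (P ^t*) P) unitarymxK // mulmx1.
by rewrite -(mulmxA _ (P ^t*) P) unitarymxK // mulmx1.
Qed.

Lemma det_conj k (A B : 'M[C]_k) :
  \det (B *m A *m B ^t*) = `|\det B| ^+ 2 * \det A.
Proof. by rewrite !det_mulmx det_map_mx det_tr mulrAC normCK. Qed.

Lemma det_unitary_conj n (P A : 'M[C]_n) : P \is unitarymx ->
  \det (P *m A *m P ^t*) = \det A.
Proof.
move=> uP.
by rewrite !det_mulmx mulrAC -det_mulmx (unitarymxP uP) det1 mul1r.
Qed.

Lemma char_poly_unitary_diag n (P : 'M[C]_n) (d : 'rV[C]_n) :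
  P \is unitarymx ->
  char_poly (P ^t* *m diag_mx d *m P) = \prod_i ('X - (d 0 i)%:P).
Proof.
move=> uP; rewrite -[RHS](_ : char_poly (diag_mx d) = _); last first.
  rewrite char_poly_trig ?diag_mx_is_trig //.
  by apply: eq_bigr => i _; rewrite mxE eqxx mulr1n.
pose Pp := map_mx polyC P; pose Qp := map_mx polyC (P ^t*).
have QP : Qp *m Pp = 1%:M by rewrite -map_mxM unitarymxK // map_mx1.
have -> : char_poly (P ^t* *m diag_mx d *m P)
   = \det (Qp *m char_poly_mx (diag_mx d) *m Pp).
  rewrite /char_poly /char_poly_mx mulmxBr mulmxBl !map_mxM.
  by rewrite (scalar_mxC _ Qp) -(mulmxA _ Qp Pp) QP mulmx1.
by rewrite !det_mulmx mulrAC -[LHS]mulrC -det_mulmx QP det1 mulr1.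
Qed.

Lemma herm_spectral k (A : 'M[C]_k) : A ^t* = A ->
  exists (P : 'M[C]_k) (d : 'rV[C]_k), [/\ P \is unitarymx,
    forall i, d 0 i \is Num.real & A = P ^t* *m diag_mx d *m P].
Proof.
move=> hA; have herm : A \is hermsymmx by rewrite qualifE /= expr0 scale1r hA.
exists (spectralmx A), (spectral_diag A).
have uP := spectral_unitarymx A; split=> //.
  by move=> i; apply/mxOverP/hermitian_spectral_diag_real.
rewrite -invmx_unitary //.
exact/orthomx_spectralP/hermitian_normalmx.
Qed.

(** * Uniqueness of the positive square root *)

(** Entrywise: [d_i^2 w = w e_j^2] forces [w = 0] or [d_i = e_j]. *)
Lemma diag_sqr_intertwine m n (d : 'rV[C]_m) (e : 'rV[C]_n) (W : 'M[C]_(m, n)) :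
  (forall i, 0 <= d 0 i) -> (forall j, 0 <= e 0 j) ->
  diag_mx d *m (diag_mx d *m W) = W *m diag_mx e *m diag_mx e ->
  diag_mx d *m W = W *m diag_mx e.
Proof.
move=> d0 e0 eW; apply/matrixP => i j.
move/matrixP/(_ i j): eW; rewrite !mul_diag_mx !mul_mx_diag !mxE => eW.
have [->|w0] := eqVneq (W i j) 0; first by rewrite mulr0 mul0r.
suff -> : d 0 i = e 0 j by rewrite mulrC.
apply/eqP; rewrite -(@eqrXn2 _ 2) //; apply/eqP/(mulIf w0).
by rewrite !expr2 -mulrA eW -mulrA mulrC.
Qed.

(** The transition matrix [P Q^*] between the two eigenbases intertwines the
    squared diagonals, hence the diagonals themselves. *)
Lemma unitary_diag_sqr_inj n (P Q A B : 'M[C]_n) (d e : 'rV[C]_n) :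
  P \is unitarymx -> Q \is unitarymx ->
  (forall i, 0 <= d 0 i) -> (forall i, 0 <= e 0 i) ->
  A = P ^t* *m diag_mx d *m P -> B = Q ^t* *m diag_mx e *m Q ->
  A *m A = B *m B -> A = B.
Proof.
move=> uP uQ d0 e0 AE BE AB.
have PA : P *m A = diag_mx d *m P by rewrite AE !mulmxA (unitarymxP uP) mul1mx.
have BQ : B *m Q ^t* = Q ^t* *m diag_mx e.
  by rewrite BE -!mulmxA (unitarymxP uQ) mulmx1.
pose W := P *m Q ^t*.
have DW : diag_mx d *m W = W *m diag_mx e.
  apply: diag_sqr_intertwine => //.
  have -> : diag_mx d *m (diag_mx d *m W) = P *m (A *m A) *m Q ^t*.
    by rewrite /W !mulmxA PA -(mulmxA _ P A) PA !mulmxA.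
  by rewrite AB -!mulmxA BQ (mulmxA B) BQ /W -!mulmxA.
have -> : A = P ^t* *m (diag_mx d *m W) *m Q.
  by rewrite AE /W -!mulmxA unitarymxK // mulmx1.
by rewrite DW BE /W !mulmxA unitarymxK // mul1mx.
Qed.

(** * Cauchy interlacing *)

(** The compression of [diag l] to the row space of [A] is at least [a].  By
    dimension, that space of dimension [j + 1] contains a nonzero [y] whose
    first [j] coordinates vanish, and [diag l] is at most [b] on [y]. *)
Lemma top_compression_le j n (A : 'M[C]_(j.+1, n)) (l : 'rV[C]_n)
    (m : 'rV[C]_j.+1) (a b : C) :
  A \is unitarymx -> A *m diag_mx l *m A ^t* = diag_mx m ->
  (forall i : 'I_n, (j <= i)%N -> l 0 i <= b) -> (forall i, a <= m 0 i) ->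
  a <= b.
Proof.
move=> uA AlA lb ma.
have jn : (j <= n)%N.
  by apply: ltnW; rewrite -(mxrank_unitary uA) rank_leq_col.
pose G := colsub (widen_ord jn) A.
(* [G] has one more row than columns *)
have : kermx G != 0.
  by rewrite kermx_eq0 -row_leq_rank -ltnNge ltnS rank_leq_col.
case/rowV0Pn => x /sub_kermxP xG x0.
pose y := x *m A.
have y0 (i : 'I_n) : (i < j)%N -> y 0 i = 0.
  move=> ij; move/rowP/(_ (Ordinal ij)): xG; rewrite mxE [RHS]mxE => xG.
  rewrite /y mxE -[RHS]xG; apply: eq_bigr => t _; rewrite [G _ _]mxE.
  by congr (_ * A _ _); apply: val_inj.
have yy : y *m y ^t* = x *m x ^t*.
  by rewrite /y trC_mul mulmxA -(mulmxA x) (unitarymxP uA) mulmx1.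
have yly : y *m diag_mx l *m y ^t* = x *m diag_mx m *m x ^t*.
  by rewrite /y trC_mul -AlA !mulmxA.
have xx : 0 < (x *m x ^t*) 0 0 by rewrite -dotmxE dnorm_gt0.
rewrite -(ler_pM2r xx).
apply: (@le_trans _ _ ((x *m diag_mx m *m x ^t*) 0 0)).
  rewrite diag_conjE gramE mulr_sumr ler_sum // => i _.
  by rewrite ler_wpM2r // mul_conjC_ge0.
rewrite -yly -yy diag_conjE gramE mulr_sumr ler_sum // => i _.
have [ij|ji] := ltnP i j; first by rewrite (y0 i ij) mul0r !mulr0.
by rewrite ler_wpM2r ?mul_conjC_ge0 ?lb.
Qed.

Lemma interlacing k n (W : 'M[C]_(k, n)) (l m : nat -> C) :
  W \is unitarymx ->
  (forall i j, (i <= j < n)%N -> l j <= l i) ->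
  (forall i j, (i <= j < k)%N -> m j <= m i) ->
  W *m diag_mx (\row_i l i) *m W ^t* = diag_mx (\row_i m i) ->
  forall j, (j < k)%N -> m j <= l j.
Proof.
move=> uW l_dec m_dec WlW j jk.
have f_inj : injective (widen_ord jk) by move=> a b /(congr1 val) /= /val_inj.
have AlA : rowsub (widen_ord jk) W *m diag_mx (\row_i l i)
    *m (rowsub (widen_ord jk) W) ^t* = diag_mx (\row_i m i).
  rewrite rowsub_conj WlW mxsub_diag //.
  by congr diag_mx; apply/rowP => i; rewrite !mxE.
apply: (top_compression_le (rowsub_unitarymx f_inj uW) AlA).
- by move=> i ji; rewrite mxE l_dec // ji ltn_ord.
- by move=> i; rewrite !mxE m_dec // -ltnS ltn_ord.
Qed.

(** * Determinants of sandwiched Hermitian matrices *)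

Definition nonneg_form k (A : 'M[C]_k) :=
  forall v : 'cV[C]_k, 0 <= (v ^t* *m A *m v) 0 0.

Lemma conj_form_ge0 k l (A : 'M[C]_k) (B : 'M[C]_(l, k)) i :
  nonneg_form A -> 0 <= (B *m A *m B ^t*) i i.
Proof.
move=> /(_ ((row i B) ^t*)); rewrite trmxCK.
have -> // : (row i B *m A *m (row i B) ^t*) 0 0 = (B *m A *m B ^t*) i i.
by rewrite -!row_mul !mxE; apply: eq_bigr => a _; rewrite !mxE; congr (_ * _).
Qed.

Lemma nonneg_form_diag_ge0 k (P A : 'M[C]_k) (d : 'rV[C]_k) i :
  P \is unitarymx -> A = P ^t* *m diag_mx d *m P -> nonneg_form A ->
  0 <= d 0 i.
Proof.
move=> uP AE /(conj_form_ge0 P i); rewrite AE unitary_diagK //.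
by rewrite mxE eqxx mulr1n.
Qed.

(** In an eigenbasis the form is a sum of terms [d_i |w_i|^2 >= 0], so each of
    them vanishes together with the sum. *)
Lemma nonneg_form_isotropic k (A : 'M[C]_k) (v : 'cV[C]_k) :
  A ^t* = A -> nonneg_form A -> (v ^t* *m A *m v) 0 0 = 0 -> A *m v = 0.
Proof.
move=> /herm_spectral[P [d [uP _ AE]]] A0 vAv.
have d0 i : 0 <= d 0 i by apply: nonneg_form_diag_ge0 uP AE A0.
have [w wE] : exists w, w = P *m v by exists (P *m v).
have dw i : d 0 i * w i 0 = 0.
  have := vAv; have -> : v ^t* *m A *m v = w ^t* *m diag_mx d *m w ^t* ^t*.
    by rewrite trmxCK AE wE trC_mul !mulmxA.
  rewrite diag_conjE.
  move/eqP; rewrite psumr_eq0; last first.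
    by move=> a _; rewrite mulr_ge0 ?mul_conjC_ge0.
  move/allP/(_ i); rewrite mem_index_enum => /(_ isT) /=.
  rewrite mulf_eq0 mul_conjC_eq0 !mxE conjC_eq0 => /orP[] /eqP E.
    by rewrite E mul0r.
  by rewrite E mulr0.
rewrite AE -mulmxA -wE -mulmxA.
suff -> : diag_mx d *m w = 0 by rewrite mulmx0.
by apply/matrixP => i j; rewrite ord1 mul_diag_mx !mxE dw.
Qed.

Lemma sandwich_nonneg_form k (T M : 'M[C]_k) :
  nonneg_form (T - M) -> nonneg_form (T + M) -> nonneg_form T.
Proof.
move=> TM0 TM1 v; have := addr_ge0 (TM0 v) (TM1 v).
rewrite !mulmxDr !mulmxDl mulmxN mulNmx !mxE addrACA addNr addr0.
by rewrite -mulr2n pmulrn_lge0.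
Qed.

(** On a null vector of [T] the form of [M] is squeezed to zero, so the vector
    is isotropic for [T + M], which kills it. *)
Lemma sandwich_kernel k (T M : 'M[C]_k) (v : 'cV[C]_k) :
  T ^t* = T -> M ^t* = M -> nonneg_form (T - M) -> nonneg_form (T + M) ->
  T *m v = 0 -> M *m v = 0.
Proof.
move=> hT hM TM0 TM1 Tv.
have vTv : v ^t* *m T *m v = 0 by rewrite -mulmxA Tv mulmx0.
have Mle : 0 <= (v ^t* *m M *m v) 0 0.
  by have := TM1 v; rewrite mulmxDr mulmxDl vTv add0r.
have Mge : 0 <= - (v ^t* *m M *m v) 0 0.
  by have := TM0 v; rewrite mulmxDr mulmxDl vTv add0r mulmxN mulNmx mxE.
have vMv : (v ^t* *m M *m v) 0 0 = 0.
  by apply/eqP; rewrite eq_le Mle andbT -oppr_ge0.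
have : (T + M) *m v = 0.
  apply: nonneg_form_isotropic => //; first by rewrite trCD hT hM.
  by rewrite mulmxDr mulmxDl vTv add0r.
by rewrite mulmxDl Tv add0r.
Qed.

Lemma diag_rsqrt_conj k (t : 'rV[C]_k) : (forall i, 0 < t 0 i) ->
  let Z := diag_mx (\row_i (sqrtC (t 0 i))^-1) in
  Z ^t* = Z /\ Z *m diag_mx t *m Z = 1%:M.
Proof.
move=> t_gt0 Z; split.
  by apply: trC_diag => i; rewrite mxE ger0_real // invr_ge0 sqrtC_ge0 ltW.
rewrite !mulmx_diag; apply/matrixP => i j; rewrite !mxE.
case: eqP => // _; rewrite !mulr1n.
have tn : sqrtC (t 0 i) != 0 by rewrite sqrtC_eq0 gt_eqF.
apply: (mulfI tn); apply: (mulIf tn).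
by rewrite mulr1 !mulrA mulfV // mul1r mulfVK // -expr2 sqrtCK.
Qed.

(** For [T] invertible, some [R1] satisfies [R1 T R1^* = 1] and
    [R1 M R1^* = diag c]; the sandwich then reads [|c i| <= 1], whence
    [|det R1|^2 |det M| <= 1 = |det R1|^2 det T].  For [T] singular, [M] is
    singular as well. *)
Lemma det_sandwich k (T M : 'M[C]_k) :
  T ^t* = T -> M ^t* = M -> nonneg_form (T - M) -> nonneg_form (T + M) ->
  `|\det M| <= \det T.
Proof.
move=> hT hM TM0 TM1.
have T0 := sandwich_nonneg_form TM0 TM1.
have [Q [t [uQ _ TE]]] := herm_spectral hT.
have t0 i : 0 <= t 0 i by apply: nonneg_form_diag_ge0 uQ TE T0.
have [/existsP[i /eqP ti]|/existsPn t_neq0] := boolP [exists i, t 0 i == 0].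
  have detT : \det T = 0.
    rewrite TE !det_mulmx det_diag (bigD1 i) //= ti mul0r.
    by rewrite mulr0 mul0r.
  pose v := Q ^t* *m delta_mx i (0 : 'I_1).
  have v0 : v != 0.
    apply/eqP => /(congr1 (mulmx Q)).
    rewrite mulmxA (unitarymxP uQ) mul1mx mulmx0.
    by move/matrixP/(_ i 0); rewrite !mxE !eqxx => /eqP; rewrite oner_eq0.
  have Tv : T *m v = 0.
    rewrite TE /v -mulmxA (mulmxA Q) (unitarymxP uQ) mul1mx -mulmxA.
    suff -> : diag_mx t *m delta_mx i (0 : 'I_1) = 0 by rewrite mulmx0.
    apply/matrixP => a b; rewrite mul_diag_mx !mxE.
    by case: eqP => [->|_]; rewrite ?ti ?mul0r // mulr0.
  have Mv := sandwich_kernel hT hM TM0 TM1 Tv.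
  have : M \notin unitmx.
    by apply: contra v0 => uM; rewrite -[v](mulKmx uM) Mv mulmx0.
  by rewrite unitmxE unitfE negbK detT => /eqP ->; rewrite normr0.
have t_gt0 i : 0 < t 0 i by rewrite lt_def t_neq0 t0.
have [hZ ZtZ] := diag_rsqrt_conj t_gt0.
set Z := diag_mx _ in hZ ZtZ.
pose R0 := Z *m Q.
have RT : R0 *m T *m R0 ^t* = 1%:M.
  have -> : R0 *m T *m R0 ^t* = Z *m (Q *m T *m Q ^t*) *m Z.
    by rewrite /R0 trC_mul hZ !mulmxA.
  by rewrite TE unitary_diagK.
have [L [c [uL c_real KE]]] := herm_spectral (trC_conj R0 hM).
pose R1 := L *m R0.
have R1T : R1 *m T *m R1 ^t* = 1%:M.
  have -> : R1 *m T *m R1 ^t* = L *m (R0 *m T *m R0 ^t*) *m L ^t*.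
    by rewrite /R1 trC_mul !mulmxA.
  by rewrite RT mulmx1 (unitarymxP uL).
have R1M : R1 *m M *m R1 ^t* = diag_mx c.
  have -> : R1 *m M *m R1 ^t* = L *m (R0 *m M *m R0 ^t*) *m L ^t*.
    by rewrite /R1 trC_mul !mulmxA.
  by rewrite KE unitary_diagK.
have c1 i : `|c 0 i| <= 1.
  have := conj_form_ge0 R1 i TM0; have := conj_form_ge0 R1 i TM1.
  rewrite !mulmxDr !mulmxDl mulmxN mulNmx R1T R1M !mxE eqxx !mulr1n.
  move=> h1 h2; rewrite real_ler_norml //; apply/andP; split.
    by rewrite -subr_ge0 opprK addrC.
  by rewrite -subr_ge0.
have dR : 0 < `|\det R1| ^+ 2.
  rewrite exprn_gt0 // normr_gt0; apply/eqP => R10.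
  have /eqP := det_conj T R1; rewrite R1T det1 R10 normr0 expr0n mul0r.
  by rewrite oner_eq0.
rewrite -(ler_pM2l dR) -det_conj R1T det1.
rewrite -[`|\det R1| ^+ 2](ger0_norm (ltW dR)) -normrM -det_conj R1M det_diag.
by rewrite normr_prod; apply: prodr_ile1 => i _; rewrite normr_ge0 c1.
Qed.

(** * Factors of the two absolute values, and rotated real parts *)

(** Here [P^* diag(d) P] is the absolute value of [X].  The factors are
    [s = diag(sqrt d) P], a square root of [|X|] up to a unitary, and
    [Y = diag(1 / sqrt d) P X^*]; inverting zero to zero is harmless because
    the column [j] of [B = X P^*] vanishes as soon as [d j = 0].  The last
    equation says that the positive matrix [Y^* Y] is [|X^*|]. *)
Lemma polar_factor n (X P : 'M[C]_n) (d : 'rV[C]_n) :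
  P \is unitarymx -> (forall i, 0 <= d 0 i) ->
  X ^t* *m X = P ^t* *m diag_mx (\row_i d 0 i ^+ 2) *m P ->
  exists s Y : 'M[C]_n, [/\ s ^t* *m s = P ^t* *m diag_mx d *m P,
    s ^t* *m Y = X ^t* & (Y ^t* *m Y) *m (Y ^t* *m Y) = X *m X ^t*].
Proof.
move=> uP d0 XX.
pose B := X *m P ^t*.
have BB : B ^t* *m B = diag_mx (\row_i d 0 i ^+ 2).
  by rewrite /B trC_mul trmxCK !mulmxA -(mulmxA P) XX unitary_diagK.
pose r := \row_i sqrtC (d 0 i); pose q := \row_i (r 0 i)^-1.
(* the indicator of the support of [d] *)
pose g := \row_i (r 0 i * q 0 i).
have r_real i : r 0 i \is Num.real by rewrite mxE ger0_real ?sqrtC_ge0.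
have q_real i : q 0 i \is Num.real by rewrite mxE realV.
have Bg : B *m diag_mx g = B.
  apply/matrixP => i j; rewrite mul_mx_diag mxE [g _ _]mxE [q _ _]mxE.
  have [rj|rj] := eqVneq (r 0 j) 0; last by rewrite mulfV // mulr1.
  have dj : d 0 j = 0.
    by apply/eqP; rewrite -sqrtC_eq0; rewrite mxE in rj; apply/eqP.
  rewrite rj mul0r mulr0; apply/esym/eqP.
  move/matrixP/(_ j j): (BB).
  rewrite -{2}[B]trmxCK gramE [RHS]mxE eqxx mxE dj expr0n /= mulr1n => /eqP.
  rewrite psumr_eq0 => [|a _]; last by rewrite mul_conjC_ge0.
  move/allP/(_ i); rewrite mem_index_enum => /(_ isT) /=.
  by rewrite mul_conjC_eq0 mxE conjC_eq0 mxE.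
pose s := diag_mx r *m P; pose Y := diag_mx q *m B ^t*.
have sT : s ^t* = P ^t* *m diag_mx r by rewrite trC_mul trC_diag.
have YT : Y ^t* = B *m diag_mx q by rewrite trC_mul trC_diag // trmxCK.
exists s, Y; split.
- have -> : s ^t* *m s = P ^t* *m (diag_mx r *m diag_mx r) *m P.
    by rewrite sT /s !mulmxA.
  rewrite mulmx_diag; congr (_ *m diag_mx _ *m _); apply/rowP => i.
  by rewrite !mxE -expr2 sqrtCK.
- have -> : s ^t* *m Y = P ^t* *m (diag_mx r *m diag_mx q *m B ^t*).
    by rewrite sT /Y !mulmxA.
  rewrite mulmx_diag -/g.
  have -> : diag_mx g = (diag_mx g) ^t*.
    by rewrite trC_diag // => i; rewrite mxE realM.
  by rewrite -trC_mul Bg /B trC_mul trmxCK mulmxA unitarymxK // mul1mx.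
- have -> : Y ^t* *m Y = B *m diag_mx (\row_i (q 0 i * q 0 i)) *m B ^t*.
    by rewrite -mulmx_diag YT /Y !mulmxA.
  set e := diag_mx _.
  have -> : B *m e *m B ^t* *m (B *m e *m B ^t*) =
      B *m (e *m (B ^t* *m B) *m e) *m B ^t* by rewrite !mulmxA.
  (* on the support of [d] this reads [(1 / d) d^2 (1 / d) = 1] *)
  have -> : e *m (B ^t* *m B) *m e = diag_mx g.
    rewrite BB !mulmx_diag; congr diag_mx; apply/rowP => i; rewrite !mxE.
    have [->|di] := eqVneq (d 0 i) 0.
      by rewrite sqrtC0 expr0n mulr0 !mul0r.
    have du : d 0 i = sqrtC (d 0 i) ^+ 2 by rewrite sqrtCK.
    have : sqrtC (d 0 i) != 0 by rewrite sqrtC_eq0.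
    by move: du; set u := sqrtC _ => -> ?; field.
  by rewrite Bg /B trC_mul trmxCK mulmxA -(mulmxA X) unitarymxK // mulmx1.
Qed.

Lemma gram_sub n (s Y X a b : 'M[C]_n) (c : C) : c * c^* = 1 ->
  s ^t* *m s = a -> Y ^t* *m Y = b -> s ^t* *m Y = X ^t* ->
  (s - c *: Y) ^t* *m (s - c *: Y) = (a + b) - (c^* *: X + c *: X ^t*).
Proof.
move=> c1 <- <- sY.
have Ys : Y ^t* *m s = X by rewrite -[s]trmxCK -trC_mul sY trmxCK.
rewrite -!scaleN1r trCD !trCZ !mulmxDl !mulmxDr -!scalemxAl -!scalemxAr.
rewrite Ys sY rmorphN rmorph1 !scalerA.
rewrite (_ : -1 * c^* * (-1 * c) = 1); last by rewrite !mulN1r mulrNN mulrC.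
rewrite scale1r !mulN1r scaleN1r !scaleNr.
move: (s ^t* *m s) (Y ^t* *m Y) (c^* *: X) (c *: X ^t*) => p q x y.
by rewrite opprD -!addrA; congr (_ + _); rewrite addrC [- x + q]addrC -addrA.
Qed.

Lemma sum_rotated_re (I : finType) n (F : I -> 'M[C]_n) (c : C) :
  \sum_i 2^-1 *: (c^* *: F i + c *: (F i) ^t*)
    = 2^-1 *: (c^* *: (\sum_i F i) + c *: (\sum_i F i) ^t*).
Proof. by rewrite trC_sum -scaler_sumr big_split /= !scaler_sumr. Qed.

Lemma rotated_reN n (A B : 'M[C]_n) (c : C) :
  2^-1 *: ((- c)^* *: A + (- c) *: B) = - (2^-1 *: (c^* *: A + c *: B)).
Proof. by rewrite rmorphN !scaleNr -opprD scalerN. Qed.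

Lemma unitarymx_scale_norm n (V H : 'M[C]_n) (c : C) : (0 < n)%N ->
  V \is unitarymx -> H \is unitarymx -> V = c *: H -> c * c^* = 1.
Proof.
move=> n0 /unitarymxP VV /unitarymxP HH VE.
move: VV; rewrite VE trCZ -scalemxAl -scalemxAr scalerA HH.
by move/matrixP/(_ (Ordinal n0) (Ordinal n0)); rewrite !mxE eqxx mulr1.
Qed.

(** This is where polar Hermitian enters: [M = (H a + a H) / 2] satisfies
    [H M = M H = N], and [H] is an involution. *)
Lemma polar_hermitian_mean n (S a V H : 'M[C]_n) (c : C) :
  a ^t* = a -> H ^t* = H -> H *m H = 1%:M -> V = c *: H -> c * c^* = 1 ->
  S = V *m a ->
  let N := 2^-1 *: (a + V *m a *m V ^t*) in
  let M := 2^-1 *: (c^* *: S + c *: S ^t*) in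
  M ^t* = M /\ N *m N = M *m M.
Proof.
move=> ha hH HH VE c1 SE N M.
have ME : M = 2^-1 *: (H *m a + a *m H).
  rewrite /M SE VE trC_mul trCZ ha hH -scalemxAl -scalemxAr !scalerA.
  by rewrite mulrC c1 !scale1r.
have NE : N = 2^-1 *: (a + H *m a *m H).
  rewrite /N VE trCZ hH -!scalemxAl -scalemxAr scalerA.
  by rewrite c1 scale1r.
have MH : M *m H = N.
  by rewrite ME NE -scalemxAl mulmxDl -(mulmxA a) HH mulmx1 addrC.
have HM : H *m M = N.
  by rewrite ME NE -scalemxAr mulmxDr !mulmxA HH mul1mx.
split.
  rewrite ME trCZ trCD !trC_mul ha hH addrC; congr (_ *: _).
  by apply/CrealP; rewrite ger0_real // invr_ge0 ler0n.
by rewrite -{1}MH -HM mulmxA -(mulmxA M H) HH mulmx1.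
Qed.

End NumClosedField.

Section RealClosedComplex.

Local Set Implicit Arguments.
Local Unset Strict Implicit.
Local Unset Printing Implicit Defensive.
Local Open Scope ring_scope.
Local Open Scope complex_scope.
Local Open Scope sesquilinear_scope.

Variable R : realType.
Local Notation C := R[i].

(** * Positive semidefinite matrices and absolute values *)

Lemma psdmx_herm n (A : 'M[C]_n) : psdmx A -> A ^t* = A.
Proof. by case; rewrite hermE => /eqP /esym. Qed.

Lemma psdmx_conj m n (A : 'M[C]_n) (B : 'M[C]_(m, n)) :
  psdmx A -> psdmx (B *m A *m B ^t*).
Proof.
move=> pA; split.
  by rewrite hermE trC_conj ?psdmx_herm.
move=> v; have [_ /(_ (B ^t* *m v))] := pA.
by rewrite trC_mul trmxCK !mulmxA.
Qed.

Lemma psd_sqr_inj n (A B : 'M[C]_n) :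
  psdmx A -> psdmx B -> A *m A = B *m B -> A = B.
Proof.
move=> pA pB; apply: (unitary_diag_sqr_inj _ _ _ _ (spectralE pA) (spectralE pB)).
- exact: spectral_unitarymx.
- exact: spectral_unitarymx.
- by move=> i; apply: spectral_diag_ge0.
- by move=> i; apply: spectral_diag_ge0.
Qed.

(** Both sides are positive square roots of [S S^*]. *)
Lemma absmx_adjoint n (S V : 'M[C]_n) :
  V \is unitarymx -> S = V *m absmx S -> absmx (S ^t*) = V *m absmx S *m V ^t*.
Proof.
move=> uV SE; apply: psd_sqr_inj; first exact: absmx_psd.
  exact/psdmx_conj/absmx_psd.
rewrite absmx_sqr trmxCK unitary_conj_sqr //; last exact/psdmx_herm/absmx_psd.
by rewrite -SE.
Qed.

(** By [gram_sub] the difference is half of a Gram matrix. *)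
Lemma symabs_sub_psd n (X : 'M[C]_n) (c : C) : c * c^* = 1 ->
  psdmx (symabs X - 2^-1 *: (c^* *: X + c *: X ^t*)).
Proof.
move=> c1; rewrite /symabs -scalerBr.
apply: psdmxZ; first by rewrite invr_ge0 ler0n.
have pXX := gram_psd X.
set e := spectral_diag (X ^t* *m X).
have e0 i : 0 <= map_mx sqrtC e 0 i by rewrite mxE sqrtC_ge0 spectral_diag_ge0.
have eE : \row_i (map_mx sqrtC e 0 i) ^+ 2 = e.
  by apply/rowP => i; rewrite !mxE sqrtCK.
have XX := spectralE pXX; rewrite -/e -[in RHS]eE in XX.
have [s [Y [ss sY YY]]] := polar_factor (spectral_unitarymx _) e0 XX.
have Yabs : Y ^t* *m Y = absmx (X ^t*).
  apply: psd_sqr_inj; [exact: gram_psd|exact: absmx_psd|].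
  by rewrite absmx_sqr trmxCK.
rewrite -(gram_sub c1 ss Yabs sY); exact: gram_psd.
Qed.

(** * Ordered eigenvalues *)

Lemma eigs_down_nonincr n (A : 'M[C]_n) i j :
  (i <= j < n)%N -> (eigs_down A)`_j <= (eigs_down A)`_i.
Proof.
case/andP=> ij jn.
have ge_tr : transitive (fun x y : R => y <= x).
  by move=> y x z yx zy; apply: le_trans zy yx.
have srt : sorted (fun x y : R => y <= x) (eigs_down A).
  by apply: sort_sorted => x y; apply: le_total.
apply: (sorted_leq_nth ge_tr _ 0 srt) => //.
  by rewrite inE size_eigs_down (leq_ltn_trans ij).
by rewrite inE size_eigs_down.
Qed.

Lemma eigs_down_ge0 n (A : 'M[C]_n) i : psdmx A -> 0 <= (eigs_down A)`_i.
Proof.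
move=> pA; have [ni|ni] := leqP n i; first by rewrite nth_default ?size_eigs_down.
have : (eigs_down A)`_i \in eigs_down A by rewrite mem_nth ?size_eigs_down.
rewrite mem_sort => /mapP[z zA ->].
by have [z0 zE] := psd_eigenvalues pA zA; rewrite -ler0c -zE.
Qed.

(** The characteristic polynomial determines the multiset of its roots, so the
    sorted eigenvalues are a permutation of the diagonal. *)
Lemma eigs_down_unitary_diag n (P A : 'M[C]_n) (d : 'rV[C]_n) :
  P \is unitarymx -> (forall i, 0 <= d 0 i) -> A = P ^t* *m diag_mx d *m P ->
  exists s : 'S_n, forall i : 'I_n, ((eigs_down A)`_i)%:C = d 0 (s i).
Proof.
move=> uP d0 AE.
have : perm_eq (eigs_down A) [tuple complex.Re (d 0 i) | i < n].
  rewrite /eigs_down perm_sort.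
  have -> : val [tuple complex.Re (d 0 i) | i < n]
      = [seq complex.Re z | z <- [seq d 0 i | i <- enum 'I_n]].
    by rewrite -map_comp.
  apply/perm_map/prod_XsubC_eq.
  by rewrite -eigenvaluesE AE char_poly_unitary_diag // big_map big_enum.
case/tuple_permP => s es; exists s => i.
rewrite es -tnth_nth !tnth_mktuple.
by case: (d 0 (s i)) (d0 (s i)) => a b; rewrite lecE /= => /andP[/eqP -> _].
Qed.

Lemma spectral_down n (A : 'M[C]_n) : psdmx A ->
  exists2 P : 'M[C]_n, P \is unitarymx &
    P *m A *m P ^t* = diag_mx (\row_i ((eigs_down A)`_i)%:C).
Proof.
move=> pA; have uP := spectral_unitarymx A.
have [s es] := eigs_down_unitary_diag uP (fun i => spectral_diag_ge0 i pA)
  (spectralE pA).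
exists (rowsub s (spectralmx A)).
  exact: rowsub_unitarymx (@perm_inj _ s) uP.
rewrite rowsub_conj {2}[A]spectralE // unitary_diagK //.
rewrite mxsub_diag; last exact: perm_inj.
by congr diag_mx; apply/rowP => i; rewrite !mxE es.
Qed.

Lemma det_psd n (A : 'M[C]_n) : psdmx A ->
  \det A = (\prod_(j < n) (eigs_down A)`_j)%:C.
Proof.
case/spectral_down => P uP PA.
have : \det (P *m A *m P ^t*) = \det A.
  exact: det_unitary_conj.
by rewrite PA det_diag rmorph_prod => <-; apply: eq_bigr => i _; rewrite mxE.
Qed.

(** The determinant of the compression is the product of all its [k]
    eigenvalues, each at most its counterpart for [A] by interlacing. *)
Lemma det_compression_le k n (A : 'M[C]_n) (U : 'M[C]_(k, n)) :
  psdmx A -> U \is unitarymx ->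
  \det (U *m A *m U ^t*) <= (\prod_(j < k) (eigs_down A)`_j)%:C.
Proof.
move=> pA uU; have pB := psdmx_conj U pA.
rewrite det_psd // lecR; apply: ler_prod => j _.
rewrite eigs_down_ge0 //=.
have [P uP PA] := spectral_down pA; have [Q uQ QB] := spectral_down pB.
have uW : Q *m U *m P ^t* \is unitarymx.
  apply: mul_unitarymx; first exact: mul_unitarymx.
  by rewrite trmxC_unitary.
pose l i := ((eigs_down A)`_i)%:C.
pose m i := ((eigs_down (U *m A *m U ^t*))`_i)%:C.
have l_dec i i' : (i <= i' < n)%N -> l i' <= l i.
  by move=> ii; rewrite lecR eigs_down_nonincr.
have m_dec i i' : (i <= i' < k)%N -> m i' <= m i.
  by move=> ii; rewrite lecR eigs_down_nonincr.
have WlW := unitary_change_basis A U Q uP.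
rewrite PA QB in WlW.
have := interlacing uW l_dec m_dec WlW (ltn_ord j).
by rewrite lecR.
Qed.

(** The compression [U] selects, in an eigenbasis common to [M] and [N], the
    vectors of the [k] largest eigenvalues of [N], which are the [k]
    eigenvalues of [M] of largest modulus. *)
Lemma prod_eigs_sandwich n k (T M N : 'M[C]_n) : (k <= n)%N ->
  psdmx T -> psdmx N -> M ^t* = M -> N *m N = M *m M ->
  psdmx (T - M) -> psdmx (T + M) ->
  \prod_(j < k) (eigs_down N)`_j <= \prod_(j < k) (eigs_down T)`_j.
Proof.
move=> kn pT pN hM NM TM0 TM1.
have [P [m [uP m_real ME]]] := herm_spectral hM.
pose d := \row_i `|m 0 i|.
have d0 i : 0 <= d 0 i by rewrite mxE.
have NE : N = P ^t* *m diag_mx d *m P.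
  apply: (psd_sqr_inj pN); first exact: diag_psd.
  rewrite NM (unitary_diag_sqr uP ME) (unitary_diag_sqr uP (erefl _)).
  have -> // : \row_i m 0 i ^+ 2 = \row_i d 0 i ^+ 2.
  by apply/rowP => i; rewrite !mxE real_normK.
have [s es] := eigs_down_unitary_diag uP d0 NE.
pose f i := s (widen_ord kn i).
have f_inj : injective f.
  by move=> i j /perm_inj /(congr1 val) /= /val_inj.
pose U := rowsub f P.
have uU : U \is unitarymx by apply: rowsub_unitarymx.
have detM : `|\det (U *m M *m U ^t*)| = (\prod_(j < k) (eigs_down N)`_j)%:C.
  rewrite rowsub_conj ME unitary_diagK // mxsub_diag // det_diag normr_prod.
  rewrite rmorph_prod.
  by apply: eq_bigr => i _; have /= -> := es (widen_ord kn i); rewrite !mxE.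
have le_det : `|\det (U *m M *m U ^t*)| <= \det (U *m T *m U ^t*).
  apply: det_sandwich; [exact/trC_conj/psdmx_herm|exact: trC_conj| |].
    by rewrite -mulmxBl -mulmxBr; case: (psdmx_conj U TM0).
  by rewrite -mulmxDl -mulmxDr; case: (psdmx_conj U TM1).
rewrite detM in le_det.
by have := le_trans le_det (det_compression_le pT uU); rewrite lecR.
Qed.

End RealClosedComplex.

Theorem corollary6p2 (R : realType) (n m : nat) (X : 'I_m -> 'M[R[i]%C]_n)
  (hX : polar_hermitian (\sum_(k < m) X k)%R) :
  wlog_maj (symabs (\sum_(k < m) X k)%R) (\sum_(k < m) symabs (X k))%R.
Proof.
move=> k /andP[k_gt0 kn]; have n_gt0 := leq_trans k_gt0 kn.
have [V [uV SE [c [H [hH uH VE]]]]] := hX.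
have c1 := unitarymx_scale_norm n_gt0 uV uH VE.
have HE : H ^t*%sesqui = H by move: hH; rewrite hermE => /eqP /esym.
have HH : (H *m H = 1%:M)%R by rewrite -{2}HE (unitarymxP uH).
have [] := polar_hermitian_mean (psdmx_herm (absmx_psd _)) HE HH VE c1 SE.
rewrite -(absmx_adjoint uV SE) -/(symabs _) => hM NM.
have sumE e :
  (\sum_(i < m) (symabs (X i) - 2^-1 *: (e^* *: X i + e *: (X i) ^t*%sesqui))
   = \sum_(i < m) symabs (X i) - 2^-1 *: (e^* *: (\sum_(k < m) X k)
       + e *: (\sum_(k < m) X k) ^t*%sesqui))%R.
  by rewrite sumrB sum_rotated_re.
apply: (prod_eigs_sandwich kn _ (symabs_psd _) hM NM).
- by apply: psdmx_sum => i; apply: symabs_psd.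
- by rewrite -sumE; apply: psdmx_sum => i; apply: symabs_sub_psd.
(* the upper bound for [- c] is the lower bound for [c] *)
- rewrite -[X in (_ + X)%R]opprK -rotated_reN -sumE.
  apply: psdmx_sum => i; apply: symabs_sub_psd.
  by rewrite rmorphN mulrNN.
Qed.
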